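(* Let $f : \mathbb{R}^n \to \mathbb{R}$ be defined by $f(x) = f_1(f_2(x))$, where $f_1 : \mathbb{R} \to \mathbb{R}$ is convex and monotonically decreasing, and $f_2 : \mathbb{R}^n \to \mathbb{R}$ is convex. For any $\tilde{x} \in \mathbb{R}^n$ and any $w \in \partial f_2(\tilde{x})$, the function $\hat{f}(\,\cdot\,; w) : \mathbb{R}^n \to \mathbb{R}$, $$\hat{f}(x; w) = f_1\big(f_2(\tilde{x}) + w^\top(x - \tilde{x})\big),$$ is convex and satisfies: (i) $\hat{f}(x;w) \ge f(x)$ for all $x \in \mathbb{R}^n$; (ii) $\hat{f}(\tilde{x};w) = f(\tilde{x})$.
   Context: $\partial f_2(\tilde{x})$ denotes the subdifferential (in the sense of convex analysis) of $f_2$ at $\tilde{x}$. *)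

(* Defs.v *)
From mathcomp Require Import all_boot all_order all_algebra.
From mathcomp Require Import classical_sets reals.

Set Implicit Arguments.
Unset Strict Implicit.
Unset Printing Implicit Defensive.

Local Open Scope classical_set_scope.
Local Open Scope ring_scope.

Section Defs.
Context {R : realType} {n : nat}.
Implicit Types (g : 'cV[R]_n -> R) (x w : 'cV[R]_n).

(* The product of a row and a column is a 1 x 1 matrix; this is its entry. *)
Definition dotcv w x : R := (w^T *m x) 0 0.

Definition subdifferential g x0 : set 'cV[R]_n :=
  [set w | forall x, g x0 + dotcv w (x - x0) <= g x].

Definition linearized_comp (f1 : R -> R) (f2 : 'cV[R]_n -> R)
    (x0 w x : 'cV[R]_n) : R :=
  f1 (f2 x0 + dotcv w (x - x0)).

End Defs.

(* Main.v *)
Require Import Defs.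
From mathcomp Require Import all_boot all_order all_algebra.
From mathcomp Require Import classical_sets reals numfun convex.

Import GRing.Theory.

Local Open Scope classical_set_scope.
Local Open Scope ring_scope.
Local Open Scope convex_scope.

(** Linearizing [f2] at [x0] replaces it by an affine function. Precomposing
    the convex [f1] with an affine function keeps it convex, because affine maps
    commute with convex combinations ([convex_function_comp], [affine_conv]).
    The subgradient inequality says that the affine function lies below [f2];
    since [f1] reverses inequalities, composing with [f1] turns this minorant
    into a majorant. At [x0] the linear part vanishes, so the two functions
    touch there. *)

Lemma dotcvD (R : realType) (n : nat) (w x y : 'cV[R]_n) :
  dotcv w (x + y) = dotcv w x + dotcv w y.
Proof. by rewrite /dotcv mulmxDr mxE. Qed.

Lemma dotcvZ (R : realType) (n : nat) (w : 'cV[R]_n) (a : R) (x : 'cV[R]_n) :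
  dotcv w (a *: x) = a * dotcv w x.
Proof. by rewrite /dotcv -scalemxAr mxE. Qed.

Lemma dotcv0 (R : realType) (n : nat) (w : 'cV[R]_n) : dotcv w 0 = 0.
Proof. by rewrite /dotcv mulmx0 mxE. Qed.

Lemma convex_function_comp (R : numFieldType) (E F : lmodType R)
    (g : convex_lmodType E -> convex_lmodType F)
    (f : convex_lmodType F -> R^o) :
  (forall t x y, g (x <| t |> y) = g x <| t |> g y) ->
  convex_function setT f -> convex_function setT (f \o g).
Proof.
move=> g_conv f_convex t x y _ _ /=.
by rewrite g_conv; apply: f_convex; rewrite in_setT.
Qed.

(** The constants [c] and [x0] survive because the weights of a convex
    combination add up to 1: each constant is its own average ([convmm]). *)
Lemma affine_conv (R : realType) (n : nat) (c : R) (w x0 : 'cV[R]_n)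
    (g := fun x : convex_lmodType 'cV[R]_n =>
            c + dotcv w (x - x0) : convex_lmodType R^o) t x y :
  g (x <| t |> y) = g x <| t |> g y.
Proof.
rewrite /g -[in LHS](convmm t (x0 : convex_lmodType 'cV[R]_n)).
rewrite -[in LHS](convmm t (c : convex_lmodType R^o)) /conv /=.
by rewrite opprD addrACA -!scalerBr dotcvD !dotcvZ addrACA !scalerDr.
Qed.

Theorem lemma3 (R : realType) (n : nat)
    (f1 : R -> R) (f2 f : 'cV[R]_n -> R)
    (f_def : forall x : 'cV[R]_n, f x = f1 (f2 x))
    (f1_convex : convex_function (E := R^o) setT f1)
    (f1_decr : nonincreasing_fun f1)
    (f2_convex : convex_function (E := 'cV[R]_n) setT f2)
    (x0 w : 'cV[R]_n) (w_sub : subdifferential f2 x0 w) :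
  [/\ convex_function (E := 'cV[R]_n) setT (linearized_comp f1 f2 x0 w),
      forall x : 'cV[R]_n, f x <= linearized_comp f1 f2 x0 w x
    & linearized_comp f1 f2 x0 w x0 = f x0].
Proof.
split.
- exact: (convex_function_comp _ _ _ _ _
            (affine_conv R n (f2 x0) w x0) f1_convex).
- by move=> x; rewrite f_def; apply: f1_decr; apply: w_sub.
- by rewrite /linearized_comp subrr dotcv0 addr0 f_def.
Qed.
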